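(* Let $q$ be a positive integer. The (essentially) unique nontrivial one-dimensional central extension of $\mathcal{B}(q)$ is given by $$[L_{\alpha,i},L_{\beta,j}]=\left(\beta(i+q)-\alpha(j+q)\right)L_{\alpha+\beta,i+j}+\phi(L_{\alpha,i},L_{\beta,j})\,c$$ for $\alpha,\beta\in\mathbb{Z}$, $i,j\in\mathbb{Z}_+$, where $c$ is a central element and $\phi$ is the non-trivial $2$-cocycle $$\phi(L_{\alpha,i},L_{\beta,j})=\delta_{\alpha+\beta,0}\,\delta_{i,0}\,\delta_{j,0}\,\frac{\alpha^3-\alpha}{12}.$$ Hence the second cohomology group of $\mathcal{B}(q)$ is $H^2(\mathcal{B}(q),\mathbb{C})=\mathbb{C}\phi$ (the one-dimensional space spanned by the class of $\phi$).
   Context: $\mathbb{Z}_+$ denotes the set of nonnegative integers; $\delta_{a,b}$ is the Kronecker delta. For a positive integer $q$, $\mathcal{B}(q)$ is the complex Lie algebra with basis $\{L_{\alpha,i}\mid \alpha\in\mathbb{Z},\ i\in\mathbb{Z}_+\}$ and bracket $[L_{\alpha,i},L_{\beta,j}]=(\beta(i+q)-\alpha(j+q))L_{\alpha+\beta,i+j}$. A $2$-cocycle on $\mathcal{B}(q)$ is a $\mathbb{C}$-bilinear form $\psi:\mathcal{B}(q)\times\mathcal{B}(q)\to\mathbb{C}$ with $\psi(x,y)=-\psi(y,x)$ and $\psi([x,y],z)+\psi([y,z],x)+\psi([z,x],y)=0$ for all $x,y,z$; the space of these is $Z^2(\mathcal{B}(q),\mathbb{C})$. For a linear function $f:\mathcal{B}(q)\to\mathbb{C}$,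 $\psi_f(x,y)=f([x,y])$ is a $2$-cocycle, called a $2$-coboundary or trivial $2$-cocycle; the space of these is $B^2(\mathcal{B}(q),\mathbb{C})$. Two $2$-cocycles are equivalent if their difference is trivial. $H^2(\mathcal{B}(q),\mathbb{C})=Z^2(\mathcal{B}(q),\mathbb{C})/B^2(\mathcal{B}(q),\mathbb{C})$. Uniqueness of the nontrivial one-dimensional central extension is understood up to equivalence of $2$-cocycles and rescaling of the central element $c$. *)

(* Defs.v *)
From HB Require Import structures.
From mathcomp Require Import all_boot all_order all_algebra.
From mathcomp Require Import finmap ring_quotient ring.
From mathcomp Require Import monalg.
From mathcomp Require Import mathcomp_extra boolp functions reals.
From mathcomp Require Import complex.

Set Implicit Arguments.
Unset Strict Implicit.
Unset Printing Implicit Defensive.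

Import Order.TTheory GRing.Theory Num.Theory.

Local Open Scope ring_scope.

HB.mixin Record isLieAlgebra (K : numFieldType) V of GRing.Lmodule K V := {
  lie : V -> V -> V;
  lie_linearl : forall y, linear (lie^~ y);
  lie_linearr : forall x, linear (lie x);
  liexx : forall x, lie x x = 0;
  lie_jacobi : forall x y z,
    lie (lie x y) z + lie (lie y z) x + lie (lie z x) y = 0
}.

#[short(type="lieAlgType")]
HB.structure Definition LieAlgebra (K : numFieldType) :=
  {V of isLieAlgebra K V & GRing.Lmodule K V}.

Section LieTheory.
Variables (K : numFieldType) (g : lieAlgType K).
Implicit Types x y z : g.

Lemma lieDl x y z : lie (x + y) z = lie x z + lie y z.
Proof. by have := lie_linearl z 1 x y; rewrite !scale1r. Qed.

Lemma lieDr x y z : lie z (x + y) = lie z x + lie z y.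
Proof. by have := lie_linearr z 1 x y; rewrite !scale1r. Qed.

Lemma lieC x y : lie x y = - lie y x.
Proof.
apply/eqP; rewrite -addr_eq0; apply/eqP.
by have := liexx (x + y); rewrite lieDl !lieDr !liexx add0r addr0.
Qed.

End LieTheory.

Definition is_lie_hom (K : numFieldType) (g h : lieAlgType K) (f : g -> h) :=
  forall x y, f (lie x y) = lie (f x) (f y).

Section Cohomology.
Variables (K : numFieldType) (g : lieAlgType K).

Definition is_2cocycle (psi : g -> g -> K^o) : Prop :=
  [/\ forall y, linear (psi^~ y),
      forall x, linear (psi x),
      forall x y, psi x y = - psi y x &
      forall x y z,
        psi (lie x y) z + psi (lie y z) x + psi (lie z x) y = 0].

Definition cocycle_pred : {pred g -> g -> K^o} :=
  fun psi => `[< is_2cocycle psi >].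

Fact cocycle_submod_closed : submod_closed cocycle_pred.
Proof.
split.
  apply/asboolP; split.
  - by move=> y a u v; rewrite scaler0 addr0.
  - by move=> x a u v; rewrite scaler0 addr0.
  - by move=> x y; rewrite oppr0.
  - by move=> x y z; rewrite !addr0.
move=> a psi chi /asboolP[psil psir psiC psiJ] /asboolP[chil chir chiC chiJ].
have E x y : (a *: psi + chi) x y = a * psi x y + chi x y by [].
apply/asboolP; split.
- move=> y b u v; rewrite !E psil chil.
  by rewrite /GRing.scale/=; ring.
- move=> x b u v; rewrite !E psir chir.
  by rewrite /GRing.scale/=; ring.
- by move=> x y; rewrite !E psiC chiC; ring.
- move=> x y z; rewrite !E.
  transitivity
    (a * (psi (lie x y) z + psi (lie y z) x + psi (lie z x) y)
     + (chi (lie x y) z + chi (lie y z) x + chi (lie z x) y)); first by ring.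
  by rewrite psiJ chiJ mulr0 addr0.
Qed.

HB.instance Definition _ :=
  GRing.isSubmodClosed.Build K (g -> g -> K^o) cocycle_pred
    cocycle_submod_closed.

Record Z2 := MkZ2 { Z2val :> g -> g -> K^o; _ : Z2val \in cocycle_pred }.

HB.instance Definition _ := [isSub for Z2val].
HB.instance Definition _ := [Choice of Z2 by <:].
HB.instance Definition _ := [SubChoice_isSubLmodule of Z2 by <:].

Lemma Z2P (psi : Z2) : is_2cocycle psi.
Proof. by apply/asboolP; case: psi. Qed.

Fact coboundary_subproof (f : {linear g -> K^o}) :
  (fun x y => f (lie x y)) \in cocycle_pred.
Proof.
apply/asboolP; split.
- by move=> y a u v /=; rewrite lie_linearl linearP.
- by move=> x a u v /=; rewrite lie_linearr linearP.
- by move=> x y; rewrite lieC linearN.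
- by move=> x y z; rewrite -!linearD lie_jacobi linear0.
Qed.

Definition coboundary (f : {linear g -> K^o}) : Z2 :=
  MkZ2 (coboundary_subproof f).

Definition B2 : {pred Z2} :=
  fun psi => `[< exists f : {linear g -> K^o}, psi = coboundary f >].

Fact B2_submod_closed : submod_closed B2.
Proof.
split.
  apply/asboolP; exists \0; apply: val_inj.
  by apply/funext => x; apply/funext => y.
move=> a psi chi /asboolP[f ->] /asboolP[h ->].
apply/asboolP; exists (a \*: f \+ h); apply: val_inj.
by apply/funext => x; apply/funext => y.
Qed.

HB.instance Definition _ := GRing.isSubmodClosed.Build K Z2 B2 B2_submod_closed.

Definition equiv_cocycle (psi chi : Z2) := psi - chi \in B2.

Definition H2 : Type := {ideal_quot B2}.
HB.instance Definition _ := GRing.Zmodule.on H2.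

Definition H2class (psi : Z2) : H2 := (\pi_{ideal_quot B2} psi)%qT.

Lemma H2class_eq (psi chi : Z2) :
  H2class psi = H2class chi <-> equiv_cocycle psi chi.
Proof.
rewrite /equiv_cocycle Quotient.idealrBE; by split=> [E|/eqP //]; apply/eqP.
Qed.

Lemma H2class_repr (h : H2) : H2class (repr (h : {ideal_quot B2})) = h.
Proof. exact: reprK. Qed.

Lemma H2classD (psi chi : Z2) :
  H2class (psi + chi) = H2class psi + H2class chi.
Proof. exact: Quotient.pi_add. Qed.

Definition H2scale (a : K) (h : H2) : H2 :=
  H2class (a *: repr (h : {ideal_quot B2})).

Lemma H2classZ (a : K) (psi : Z2) : H2class (a *: psi) = H2scale a (H2class psi).
Proof.
apply/H2class_eq; rewrite /equiv_cocycle -scalerBr; apply: rpredZ.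
exact/H2class_eq/esym/H2class_repr.
Qed.

Fact H2scaleA a b h : H2scale a (H2scale b h) = H2scale (a * b) h.
Proof. by rewrite -[h]H2class_repr -!H2classZ scalerA. Qed.
Fact H2scale1 : left_id 1 H2scale.
Proof. by move=> h; rewrite -[h]H2class_repr -H2classZ scale1r. Qed.
Fact H2scaleDr : right_distributive H2scale +%R.
Proof.
move=> a h k; rewrite -[h]H2class_repr -[k]H2class_repr.
by rewrite -!(H2classZ, H2classD) scalerDr.
Qed.
Fact H2scaleDl h : {morph H2scale^~ h : a b / a + b}.
Proof.
by move=> a b; rewrite -[h]H2class_repr -!(H2classZ, H2classD) scalerDl.
Qed.
HB.instance Definition _ :=
  GRing.Zmodule_isLmodule.Build K H2 H2scaleA H2scale1 H2scaleDr H2scaleDl.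

End Cohomology.

Arguments B2 {K} g _.

Section CentralExtensions.
Variables (K : numFieldType) (g : lieAlgType K).

(* A one-dimensional central extension 0 -> K c -> E -> g -> 0. *)
Record centralExt := CentralExt {
  ext_alg :> lieAlgType K;
  ext_proj : {linear ext_alg -> g};
  ext_c : ext_alg;
  ext_proj_hom : is_lie_hom ext_proj;
  ext_proj_surj : forall x : g, exists e, ext_proj e = x;
  ext_ker : forall e, ext_proj e = 0 <-> exists a : K, e = a *: ext_c;
  ext_c_neq0 : ext_c != 0;
  ext_central : forall e, lie ext_c e = 0
}.

Definition trivial_ext (E : centralExt) :=
  exists s : {linear g -> E}, is_lie_hom s /\ cancel s (ext_proj E).

(* Since f commutes with the projections, it maps the line K c onto the line
   K c', but it may send c to a nonzero multiple of c': this is equivalence up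
   to a rescaling of the central element. *)
Definition equiv_ext (E E' : centralExt) :=
  exists f : {linear E -> E'},
    [/\ bijective f, is_lie_hom f &
        forall e, ext_proj E' (f e) = ext_proj E e].

Definition cext (psi : Z2 g) : Type := (g * K^o)%type.

Variable psi : Z2 g.

HB.instance Definition _ := GRing.Lmodule.copy (cext psi) (g * K^o)%type.

Definition cext_lie (x y : cext psi) : cext psi :=
  (lie x.1 y.1, psi x.1 y.1).

Fact cext_linearl y : linear (cext_lie^~ y).
Proof.
move=> a u v; rewrite /cext_lie /= lie_linearl.
by have [-> _ _ _] := Z2P psi.
Qed.

Fact cext_linearr x : linear (cext_lie x).
Proof.
move=> a u v; rewrite /cext_lie /= lie_linearr.
by have [_ -> _ _] := Z2P psi.
Qed.

Fact cext_liexx x : cext_lie x x = 0.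
Proof.
rewrite /cext_lie liexx; have [_ _ psiC _] := Z2P psi.
have /eqP := psiC x.1 x.1; rewrite -addr_eq0 -mulr2n mulrn_eq0 /= => /eqP ->.
by [].
Qed.

Fact cext_jacobi x y z :
  cext_lie (cext_lie x y) z + cext_lie (cext_lie y z) x
    + cext_lie (cext_lie z x) y = 0.
Proof.
have [_ _ _ psiJ] := Z2P psi.
by apply: (congr2 pair) => /=; [exact: lie_jacobi | exact: psiJ].
Qed.

HB.instance Definition _ := isLieAlgebra.Build K (cext psi)
  cext_linearl cext_linearr cext_liexx cext_jacobi.

Definition cext_c : cext psi := (0, 1).
Definition cext_in (x : g) : cext psi := (x, 0).
Definition cext_proj (e : cext psi) : g := e.1.

Fact cext_proj_linear : linear cext_proj. Proof. by []. Qed.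
HB.instance Definition _ :=
  GRing.isLinear.Build K (cext psi) g _ cext_proj cext_proj_linear.

Fact cext_proj_hom : is_lie_hom cext_proj. Proof. by []. Qed.
Fact cext_proj_surj (x : g) : exists e, cext_proj e = x.
Proof. by exists (cext_in x). Qed.
Fact cext_ker e : cext_proj e = 0 <-> exists a : K, e = a *: cext_c.
Proof.
split=> [|[a ->]]; last by rewrite linearZ /= scaler0.
case: e => x a /= x0; exists a; apply: (congr2 pair).
  by rewrite scaler0.
by rewrite /= /GRing.scale /= mulr1.
Qed.
Fact cext_c_neq0 : cext_c != 0.
Proof. by apply/eqP => -[] /eqP; rewrite oner_eq0. Qed.
Fact cext_central e : lie cext_c e = 0.
Proof.
have [psil _ _ _] := Z2P psi.
apply: (congr2 pair) => /=.
  by have := lie_linearl e.1 (-1) 0 0; rewrite scaler0 addr0 scaleN1r addNr.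
by have := psil e.1 (-1) 0 0; rewrite scaler0 addr0 scaleN1r addNr.
Qed.

(* The extension of g by the cocycle psi:
   [x + a c, y + b c] = [x, y] + psi(x, y) c. *)
Definition cocycle_ext : centralExt :=
  @CentralExt (cext psi) cext_proj cext_c cext_proj_hom cext_proj_surj
    cext_ker cext_c_neq0 cext_central.

End CentralExtensions.

HB.lock Definition lin_ext (K : numFieldType) (I : choiceType)
    (V : lmodType K) (F : I -> V) (x : {malg K[I]}) : V :=
  \sum_(k <- msupp x) x@_k *: F k.
Canonical lin_ext_unlockable := Unlockable lin_ext.unlock.

Section LinearExtension.
Variables (K : numFieldType) (I : choiceType) (V : lmodType K).
Implicit Types (F : I -> V) (x : {malg K[I]}).

Lemma lin_extE F x : lin_ext F x = \sum_(k <- msupp x) x@_k *: F k.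
Proof. by rewrite unlock. Qed.

Lemma lin_extEw F x (D : {fset I}) : (msupp x `<=` D)%fset ->
  lin_ext F x = \sum_(k <- D) x@_k *: F k.
Proof.
move=> le; rewrite unlock; apply: big_fset_incl => // k _ /mcoeff_outdom ->.
by rewrite scale0r.
Qed.

Fact lin_ext_linear F : linear (lin_ext F).
Proof.
move=> a x y.
pose D := (msupp x `|` msupp y `|` msupp (a *: x + y))%fset.
rewrite (@lin_extEw _ (a *: x + y) D) ?fsubsetUr //.
rewrite (@lin_extEw _ x D); last first.
  by rewrite /D -fsetUA fsubsetUl.
rewrite (@lin_extEw _ y D); last first.
  by rewrite /D (fsetUC (msupp x)) -fsetUA fsubsetUl.
rewrite scaler_sumr -big_split; apply: eq_bigr => k _ /=.
by rewrite mcoeffD mcoeffZ scalerDl scalerA.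
Qed.

Lemma lin_extU F k : lin_ext F << k >> = F k.
Proof. by rewrite unlock msuppU oner_eq0 big_seq_fset1 mcoeffUU scale1r. Qed.

Lemma malg_lin0 (f : {malg K[I]} -> V) :
  linear f -> (forall k, f << k >> = 0) -> forall x, f x = 0.
Proof.
move=> fL f0 x.
pose fM := GRing.isLinear.Build K {malg K[I]} V _ f fL.
pose f' : {linear _ -> _} := HB.pack f fM.
rewrite -[f]/(f' : _ -> _) [x]monalgE linear_sum big1 // => k _.
have -> : << x@_k *g k >> = x@_k *: << k >> :> {malg K[I]}.
  by apply/malgP => j; rewrite mcoeffZ !mcoeffU mulr_natr.
by rewrite linearZ /= f0 scaler0.
Qed.

End LinearExtension.

Section Block.
Variable (K : numFieldType).

(* The free K-module on the basis int * nat: finitely supported functions. *)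
Definition block (q : nat) : Type := {malg K[(int * nat)%type]}.

Variable q : nat.

HB.instance Definition _ :=
  GRing.Lmodule.copy (block q) {malg K[(int * nat)%type]}.

Definition blockL (alpha : int) (i : nat) : block q := << (alpha, i) >>.

Definition block_coef (a b : int * nat) : K :=
  (b.1 * (a.2 + q)%:Z - a.1 * (b.2 + q)%:Z)%:~R.

Definition block_lie (x y : block q) : block q :=
  lin_ext (fun a => lin_ext (fun b =>
    block_coef a b *: blockL (a.1 + b.1) (a.2 + b.2)) y) x.

Fact block_lie_linearl y : linear (block_lie^~ y).
Proof. exact: lin_ext_linear. Qed.

Fact block_lie_linearr x : linear (block_lie x).
Proof.
move=> a u v; rewrite /block_lie !lin_extE scaler_sumr -big_split.
by apply: eq_bigr => k _ /=; rewrite lin_ext_linear scalerDr !scalerA mulrC.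
Qed.

Lemma block_lieL a b :
  block_lie << a >> << b >>
    = block_coef a b *: blockL (a.1 + b.1) (a.2 + b.2).
Proof. by rewrite /block_lie !lin_extU. Qed.

Let lin (f : block q -> block q) := linear f.

Let linD f h : lin f -> lin h -> lin (fun x => f x + h x).
Proof. by move=> fL hL a u v; rewrite fL hL scalerDr addrACA. Qed.

Let lin_lieL f y : lin f -> lin (fun x => block_lie (f x) y).
Proof. by move=> fL a u v; rewrite fL block_lie_linearl. Qed.

Let lin_lieR f y : lin f -> lin (fun x => block_lie y (f x)).
Proof. by move=> fL a u v; rewrite fL block_lie_linearr. Qed.

Let lin_id : lin (fun x => x). Proof. by []. Qed.

Let lin_eq0 f : lin f -> (forall k, f << k >> = 0) -> forall x, f x = 0.
Proof. exact: malg_lin0. Qed.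

Fact block_lieC x y : block_lie x y + block_lie y x = 0.
Proof.
move: x; apply: lin_eq0; first exact: linD (lin_lieL _ lin_id) (lin_lieR _ lin_id).
move=> a; move: y; apply: lin_eq0.
  exact: linD (lin_lieR _ lin_id) (lin_lieL _ lin_id).
move=> b; rewrite !block_lieL [b.1 + _]addrC [(b.2 + _)%N]addnC -scalerDl.
rewrite /block_coef -rmorphD /= (_ : _ + _ = 0) ?scale0r //; ring.
Qed.

Fact block_liexx x : block_lie x x = 0.
Proof.
move: (block_lie x x) (block_lieC x x) => w /(congr1 (fun v => 2^-1 *: v)).
by rewrite scaler0 scalerDr -scalerDl -[X in X + X]mul1r -splitr scale1r.
Qed.

Let lie_scalel c x y : block_lie (c *: x) y = c *: block_lie x y.
Proof.
have h0 : block_lie 0 y = 0.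
  by have := block_lie_linearl y (-1) 0 0; rewrite scaler0 addr0 scaleN1r addNr.
by have := block_lie_linearl y c x 0; rewrite !addr0 h0 addr0.
Qed.

Let lieLL a b c : block_lie (block_lie << a >> << b >>) << c >> =
  (block_coef a b * block_coef (a.1 + b.1, (a.2 + b.2)%N) c)
    *: blockL (a.1 + b.1 + c.1) (a.2 + b.2 + c.2).
Proof.
rewrite (block_lieL a b) lie_scalel.
by rewrite (block_lieL (a.1 + b.1, (a.2 + b.2)%N) c) scalerA.
Qed.

Fact block_jacobi x y z :
  block_lie (block_lie x y) z + block_lie (block_lie y z) x
    + block_lie (block_lie z x) y = 0.
Proof.
move: x; apply: lin_eq0.
  exact: linD (linD (lin_lieL _ (lin_lieL _ lin_id)) (lin_lieR _ lin_id))
    (lin_lieL _ (lin_lieR _ lin_id)).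
move=> a; move: y; apply: lin_eq0.
  exact: linD (linD (lin_lieL _ (lin_lieR _ lin_id))
    (lin_lieL _ (lin_lieL _ lin_id))) (lin_lieR _ lin_id).
move=> b; move: z; apply: lin_eq0.
  exact: linD (linD (lin_lieR _ lin_id) (lin_lieL _ (lin_lieR _ lin_id)))
    (lin_lieL _ (lin_lieL _ lin_id)).
move=> c; apply: (etrans (congr2 +%R (congr2 +%R (lieLL a b c) (lieLL b c a))
  (lieLL c a b))).
have -> : b.1 + c.1 + a.1 = a.1 + b.1 + c.1 by ring.
have -> : c.1 + a.1 + b.1 = a.1 + b.1 + c.1 by ring.
have -> : (b.2 + c.2 + a.2 = a.2 + b.2 + c.2)%N by rewrite addnC addnA.
have -> : (c.2 + a.2 + b.2 = a.2 + b.2 + c.2)%N by rewrite -addnA addnC.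
rewrite -!scalerDl /block_coef /= -!rmorphM -!rmorphD /=.
rewrite !PoszD (_ : _ + _ = 0) ?scale0r //; ring.
Qed.

HB.instance Definition _ := isLieAlgebra.Build K (block q)
  block_lie_linearl block_lie_linearr block_liexx block_jacobi.

Lemma lie_blockL alpha i beta j :
  lie (blockL alpha i) (blockL beta j)
    = (beta * (i + q)%:Z - alpha * (j + q)%:Z)%:~R *: blockL (alpha + beta) (i + j).
Proof. exact: block_lieL. Qed.

End Block.

(* Main.v *)
Require Import Defs.
From HB Require Import structures.
From mathcomp Require Import all_boot all_order all_algebra.
From mathcomp Require Import ring zify.
From mathcomp Require Import boolp reals complex.

Set Implicit Arguments.
Unset Strict Implicit.
Unset Printing Implicit Defensive.

Import Order.TTheory GRing.Theory Num.Theory.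

Local Open Scope ring_scope.

(**
Write L(a,i) for the basis vectors of the Lie algebra. Two gradings control
everything: the weight a, which is the eigenvalue of ad L(0,0) up to the factor
q, and the degree i.

A coboundary is a linear form evaluated on brackets, and every L(a,n) is, up to
a nonzero scalar, a bracket: of L(0,0) with L(a,n) when a is nonzero, and of
L(1,0) with L(-1,n) when a = 0, the scalar being then -(n + 2q). So a cocycle
can be changed by a coboundary until it vanishes on these pairs. The cocycle
identity with L(0,0) as one argument then kills it on all pairs of total weight
nonzero (off_weight), and the values w(a;i,j) on pairs L(a,i), L(-a,j) remain.

The cocycle identity for the weights a, -a, 0 says that w(a;i+k,j) - w(a;i,j+k)
is a multiple of w(0;i+j,k) which depends neither on a nor on how i + j is split
(zero_wt_shift). Hence w(a;i,j) is affine in i when i + j is fixed, and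
antisymmetry forces its slope to be zero (slope_eq0): w(a;i,j) depends on a and
n = i + j only, and w(0;i,j) = 0. If n > 0, comparing the identities of degrees
(n,0,0) and (0,n,0) shows that w is additive in a, and it vanishes for a = 1
(zero_wt_pos_deg). If n = 0, the classical recursion
(a - 1) w(a+1) = (a + 2) w(a) of the Witt algebra leaves the multiples of
a^3 - a (zero_wt_deg0). This gives cocycle_class: every cocycle is a multiple of
the Virasoro cocycle up to a coboundary. The Virasoro cocycle is not a
coboundary, because a linear form that represents it has to vanish on L(0,0),
by the pair L(1,0), L(-1,0), and then gives 0 on L(2,0), L(-2,0), where the
cocycle is 1/2.

The statements on extensions follow because a central extension with a linear
section s is the extension by the cocycle that measures the failure of s to
preserve brackets (section_cocycle); a cohomologous cocycle, or a nonzero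
multiple of one, changes the isomorphism with the extension only by a shear and
a rescaling along the central line (equiv_cocycle_ext).
*)

(** * Cocycles and central extensions of a Lie algebra *)

Section CentralExtension.
Variables (K : numFieldType) (g : lieAlgType K).

Lemma linear_of (U V : lmodType K) (f : U -> V) :
  linear f -> {h : {linear U -> V} | h =1 f}.
Proof.
move=> fL; pose fM := GRing.isLinear.Build K U V _ f fL.
by pose f' : {linear U -> V} := HB.pack f fM; exists f'.
Qed.

Lemma mem_B2P (psi : Z2 g) :
  psi \in B2 g <->
  exists f : {linear g -> K^o}, forall x y, psi x y = f (lie x y).
Proof.
split=> [/asboolP[f ->]|[f psif]]; first by exists f.
apply/asboolP; exists f; apply: val_inj.
by apply/funext => x; apply/funext => y; exact: psif.
Qed.

Lemma Z2B (psi chi : Z2 g) x y : (psi - chi) x y = psi x y - chi x y.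
Proof. by []. Qed.
Lemma Z2Z a (psi : Z2 g) x y : (a *: psi) x y = a * psi x y.
Proof. by []. Qed.

Lemma cocycleC (psi : Z2 g) x y : psi x y = - psi y x.
Proof. by have [_ _ -> _] := Z2P psi. Qed.

Lemma cocycleZl (psi : Z2 g) a x y : psi (a *: x) y = a * psi x y.
Proof.
have [psil _ _ _] := Z2P psi.
have h0 : psi 0 y = 0.
  by have := psil y (-1) 0 0; rewrite scaler0 addr0 scaleN1r addNr.
by have := psil y a x 0; rewrite !addr0 h0 addr0.
Qed.

(** A splitting of the extension is x |-> (x, f x), and it preserves brackets
exactly when the cocycle is the coboundary of f. *)
Lemma trivial_cocycle_ext (psi : Z2 g) :
  trivial_ext (cocycle_ext psi) -> psi \in B2 g.
Proof.
case=> s [sH sK]; apply/mem_B2P.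
have [|f fE] := @linear_of g K^o (fun x => (s x : cext psi).2).
  by move=> a u v; rewrite linearP.
exists f => x y; rewrite fE sH /=.
have sE z : (s z : cext psi).1 = z by exact: sK.
by rewrite /lie /= !sE.
Qed.

Section Split.
Variables (E : centralExt g) (s : {linear g -> E}).
Hypothesis sK : cancel s (ext_proj E).
Let p := ext_proj E.
Let c := ext_c E.

Lemma lieZ_central_l (a : K) (e : E) : lie (a *: c) e = 0.
Proof.
have h0 : lie (0 : E) e = 0.
  by have := lie_linearl e (-1) (0:E) 0; rewrite scaler0 addr0 scaleN1r addNr.
by have := lie_linearl e a c 0; rewrite !addr0 h0 addr0 ext_central scaler0.
Qed.

(** The coordinate along the central line of a vector relative to the section:
e - s (p e) lies in the kernel of the projection, which is that line. *)
Lemma central_coord :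
  {k : {linear E -> K^o} | forall e, e = s (p e) + k e *: c}.
Proof.
have ex e : exists a : K, e - s (p e) = a *: c.
  by apply/ext_ker; rewrite linearB /= sK subrr.
pose k e : K := projT1 (cid (ex e)).
have kE e : e - s (p e) = k e *: c by rewrite /k; case: cid.
have cI (a b : K) : a *: c = b *: c -> a = b.
  move/eqP; rewrite -subr_eq0 -scalerBl scaler_eq0 (negPf (ext_c_neq0 E)) orbF.
  by rewrite subr_eq0 => /eqP.
have [|h hE] := @linear_of E K^o k.
  move=> a u v; apply: cI; rewrite -kE scalerDl.
  have -> : (a *: (k u : K^o)) *: c = a *: (k u *: c) by rewrite scalerA.
  by rewrite -!kE !linearP scalerDr addrACA.
by exists h => e; rewrite hE -kE addrC subrK.
Qed.

Variable k : {linear E -> K^o}.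
Hypothesis kE : forall e, e = s (p e) + k e *: c.

Lemma central_coord_section x : k (s x) = 0.
Proof.
have /esym/eqP := kE (s x); rewrite sK -subr_eq0 addrAC subrr add0r scaler_eq0.
by rewrite (negPf (ext_c_neq0 E)) orbF => /eqP.
Qed.

Lemma lie_via_section e1 e2 : lie e1 e2 = lie (s (p e1)) (s (p e2)).
Proof.
rewrite [in LHS](kE e1) lieDl lieZ_central_l addr0 lieC [in LHS](kE e2).
by rewrite lieDl lieZ_central_l addr0 -lieC.
Qed.

(** The Jacobi identity of the extension gives the cocycle identity, because
s [x, y] and [s x, s y] differ by a central element and so have the same
bracket with s z. *)
Lemma section_cocycle_proof :
  (fun x y => k (lie (s x) (s y))) \in @cocycle_pred K g.
Proof.
apply/asboolP; split.
- by move=> y a u v; rewrite linearP lie_linearl linearP.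
- by move=> x a u v; rewrite linearP lie_linearr linearP.
- by move=> x y; rewrite lieC linearN.
have step x y z : lie (s (lie x y)) (s z) = lie (lie (s x) (s y)) (s z).
  by rewrite [RHS]lie_via_section ext_proj_hom !sK.
by move=> x y z; rewrite !step -!linearD lie_jacobi linear0.
Qed.

Definition section_cocycle : Z2 g := MkZ2 section_cocycle_proof.

Lemma lie_section x y :
  lie (s x) (s y) = s (lie x y) + section_cocycle x y *: c.
Proof. by rewrite [LHS]kE ext_proj_hom !sK. Qed.

(** If the cocycle is the coboundary of f, the section s + f c, corrected along
the central line, preserves brackets. *)
Lemma section_cocycle_trivial : section_cocycle \in B2 g -> trivial_ext E.
Proof.
move=> /mem_B2P[f fE].
have [|t tE] := @linear_of g E (fun x => s x + (f x : K) *: c).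
  move=> a u v; rewrite !linearP scalerDl scalerDr addrACA; congr (_ + (_ + _)).
  by rewrite scalerA.
have pc (a : K) : p (a *: c) = 0 by apply/ext_ker; exists a.
have pt x : p (t x) = x by rewrite tE linearD /= sK pc addr0.
exists t; split=> // x y.
by rewrite [RHS]lie_via_section !pt lie_section tE fE.
Qed.

(** With psi = a phi + df, the isomorphism sends s x + t c to
(x, (t - f x) / a): the shear by f removes df, and the division by a rescales
the center. *)
Lemma equiv_cocycle_ext (phi : Z2 g) (a : K) : a != 0 ->
  equiv_cocycle section_cocycle (a *: phi) -> equiv_ext E (cocycle_ext phi).
Proof.
move=> a0 /mem_B2P[f fE].
have {}fE x y : section_cocycle x y = a * phi x y + f (lie x y).
  by rewrite -fE Z2B Z2Z addrC subrK.
have [|F FE] := @linear_of E (cext phi)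
    (fun e => (p e, a^-1 * (k e - f (p e)))).
  move=> b u v; rewrite !linearP; apply: (congr2 pair) => //=.
  by rewrite /GRing.scale /=; ring.
have pc (b : K) : p (b *: c) = 0 by apply/ext_ker; exists b.
have kc (b : K) : k (b *: c) = b.
  have /esym/eqP := kE (b *: c); rewrite pc linear0 add0r -subr_eq0 -scalerBl.
  by rewrite scaler_eq0 (negPf (ext_c_neq0 E)) orbF subr_eq0 => /eqP.
exists F; split.
- exists (fun z : cext phi => s z.1 + (a * z.2 + f z.1 : K) *: c).
    move=> e; rewrite FE /= mulrA divff // mul1r subrK; exact/esym/kE.
  move=> [x b]; rewrite FE /= linearD /= sK pc addr0 linearD /=.
  rewrite central_coord_section kc add0r; congr pair.
  by rewrite addrK mulrA mulVf // mul1r.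
- move=> e1 e2; rewrite !FE; apply: (congr2 pair) => /=.
    by rewrite ext_proj_hom.
  rewrite lie_via_section ext_proj_hom.
  have -> : k (lie (s (p e1)) (s (p e2))) = section_cocycle (p e1) (p e2) by [].
  by rewrite fE /p !sK addrK mulrA mulVf // mul1r.
- by move=> e; rewrite FE.
Qed.

End Split.
End CentralExtension.

(** * Linear and bilinear maps given on the basis *)

Section Block.
Variables (K : numFieldType) (q : nat).
Local Notation L := (blockL K q).
Local Notation g := (block K q).

Lemma block_linear_eq (V : lmodType K) (f h : g -> V) :
  linear f -> linear h -> (forall al i, f (L al i) = h (L al i)) -> f =1 h.
Proof.
move=> fL hL fh x; apply/eqP; rewrite -subr_eq0; apply/eqP; move: x.
apply: (@malg_lin0 K (int * nat)%type V (fun x => f x - h x)) => [a u v|[al i]].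
  by rewrite fL hL scalerBr opprD addrACA.
by apply/eqP; rewrite subr_eq0; apply/eqP; exact: fh.
Qed.

Definition block_lin (V : lmodType K) (F : int -> nat -> V) : g -> V :=
  lin_ext (fun a => F a.1 a.2).

Lemma block_lin_linear (V : lmodType K) (F : int -> nat -> V) :
  linear (block_lin F).
Proof. exact: lin_ext_linear. Qed.

Lemma block_linE (V : lmodType K) (F : int -> nat -> V) al i :
  block_lin F (L al i) = F al i.
Proof. exact: lin_extU. Qed.

Lemma block_bilinear_eq (f h : g -> g -> K^o) :
  (forall y, linear (f^~ y)) -> (forall x, linear (f x)) ->
  (forall y, linear (h^~ y)) -> (forall x, linear (h x)) ->
  (forall al i be j, f (L al i) (L be j) = h (L al i) (L be j)) -> f =2 h.
Proof.
move=> fl fr hl hr fh x y; move: x; apply: block_linear_eq => // al i.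
by move: y; apply: block_linear_eq => // be j.
Qed.

Lemma linear_lie_basis (f : {linear g -> K^o}) al i be j :
  f (lie (L al i) (L be j)) =
  (be * (i + q)%:Z - al * (j + q)%:Z)%:~R * f (L (al + be) (i + j)).
Proof. by rewrite lie_blockL linearZ. Qed.

Lemma Z2_eq (psi chi : Z2 g) :
  (forall al i be j, psi (L al i) (L be j) = chi (L al i) (L be j)) ->
  psi = chi.
Proof.
have [? ? _ _] := Z2P psi; have [? ? _ _] := Z2P chi.
move=> E; apply: val_inj; apply/funext => x; apply/funext => y.
exact: block_bilinear_eq.
Qed.

Lemma cocycle_lie_basis (psi : Z2 g) al i be j (z : g) :
  psi (lie (L al i) (L be j)) z =
  (be * (i + q)%:Z - al * (j + q)%:Z)%:~R * psi (L (al + be) (i + j)) z.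
Proof. by rewrite lie_blockL; exact: cocycleZl. Qed.

(** The cocycle conditions read on basis vectors: w al i be j stands for the
value on L(al,i), L(be,j). *)
Definition basis_cocycle (w : int -> nat -> int -> nat -> K) : Prop :=
  (forall al i be j, w al i be j = - w be j al i) /\
  (forall al i be j ga k,
    (be * (i + q)%:Z - al * (j + q)%:Z)%:~R * w (al + be) (i + j)%N ga k
    + (ga * (j + q)%:Z - be * (k + q)%:Z)%:~R * w (be + ga) (j + k)%N al i
    + (al * (k + q)%:Z - ga * (i + q)%:Z)%:~R * w (ga + al) (k + i)%N be j = 0).

Lemma cocycle_basis (psi : Z2 g) :
  basis_cocycle (fun al i be j => psi (L al i) (L be j)).
Proof.
have [_ _ _ psiJ] := Z2P psi; split=> [al i be j|al i be j ga k].
  exact: cocycleC.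
by rewrite -!cocycle_lie_basis psiJ.
Qed.

Section OfBasis.
Variables (w : int -> nat -> int -> nat -> K) (wcocycle : basis_cocycle w).

Definition basis_form (x y : g) : K^o :=
  block_lin (fun al i => block_lin (fun be j => w al i be j : K^o) y) x.

Lemma basis_form_linearl y : linear (basis_form^~ y).
Proof. exact: block_lin_linear. Qed.

Lemma basis_form_linearr x : linear (basis_form x).
Proof.
move=> a u v; move: x; apply: block_linear_eq; first exact: basis_form_linearl.
  by move=> b x y; rewrite !(basis_form_linearl _ b x y) /GRing.scale /=; ring.
by move=> al i; rewrite /basis_form !block_linE; exact: block_lin_linear.
Qed.

Lemma basis_formE al i be j : basis_form (L al i) (L be j) = w al i be j.
Proof. by rewrite /basis_form !block_linE. Qed.

(** The Jacobi sum J is trilinear and invariant under cyclic permutations, so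
linearity in the last argument is enough to reduce each argument in turn to a
basis vector. *)
Lemma basis_form_cocycle : basis_form \in @cocycle_pred K g.
Proof.
have [wC wJ] := wcocycle.
have fl := basis_form_linearl; have fr := basis_form_linearr.
have fC x y : basis_form x y = - basis_form y x.
  apply: (@block_bilinear_eq basis_form (fun x y => - basis_form y x)) => //.
  - by move=> z a u v; rewrite fr /GRing.scale /=; ring.
  - by move=> z a u v; rewrite fl /GRing.scale /=; ring.
  - by move=> al i be j; rewrite !basis_formE wC.
pose J x y z :=
  basis_form (lie x y) z + basis_form (lie y z) x + basis_form (lie z x) y.
have Jcyc x y z : J x y z = J y z x by rewrite /J -addrA addrC.
have Jlin x y : linear (J x y).
  move=> a u v; rewrite /J fr lie_linearr lie_linearl !fl.
  by rewrite /GRing.scale /=; ring.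
have zlin : linear (fun _ : g => 0 : K^o).
  by move=> a u v; rewrite scaler0 addr0.
have fZ a x y : basis_form (a *: x) y = a * basis_form x y.
  have h0 : basis_form 0 y = 0.
    by have := fl y (-1) 0 0; rewrite scaler0 addr0 scaleN1r addNr.
  by have := fl y a x 0; rewrite !addr0 h0 addr0.
have lieE al i be j ga k : basis_form (lie (L al i) (L be j)) (L ga k) =
    (be * (i + q)%:Z - al * (j + q)%:Z)%:~R * w (al + be) (i + j)%N ga k.
  by rewrite lie_blockL fZ basis_formE.
apply/asboolP; split=> // x y z; rewrite -/(J x y z).
move: z; apply: (block_linear_eq (Jlin x y) zlin) => ga k; rewrite Jcyc Jcyc.
move: y; apply: (block_linear_eq (Jlin _ x) zlin) => be j; rewrite Jcyc Jcyc.
move: x; apply: (block_linear_eq (Jlin _ _) zlin) => al i; rewrite Jcyc Jcyc.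
by rewrite /J (lieE al i be j) (lieE be j ga k) (lieE ga k al i).
Qed.

Definition basis_Z2 : Z2 g := MkZ2 basis_form_cocycle.

Lemma basis_Z2E al i be j : basis_Z2 (L al i) (L be j) = w al i be j.
Proof. exact: basis_formE. Qed.

End OfBasis.

(** * The Virasoro cocycle *)

Definition vir_val (al : int) (i : nat) (be : int) (j : nat) : K :=
  (al + be == 0)%:R * (i == 0%N)%:R * (j == 0%N)%:R
    * ((al%:~R ^+ 3 - al%:~R) / 12%:R).

(** When the three weights do not sum to zero, or some degree is positive, each
term vanishes; in degree zero the bracket is q times the bracket of the Witt
algebra, and the identity is the one of the Gelfand-Fuchs cocycle. *)
Lemma vir_val_cocycle : basis_cocycle vir_val.
Proof.
split=> [al i be j|al i be j ga k]; rewrite /vir_val.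
  rewrite addrC; have [/eqP|_] := eqVneq (be + al) 0; last first.
    by rewrite !mul0r oppr0.
  by rewrite addr_eq0 => /eqP ->; rewrite rmorphN /=; ring.
have -> : be + ga + al = al + be + ga by ring.
have -> : ga + al + be = al + be + ga by ring.
have [/eqP|_] := eqVneq (al + be + ga) 0; last by rewrite !mul0r !mulr0 !addr0.
rewrite addrC addr_eq0 => /eqP ->.
case: i j k => [|i] [|j] [|k] /=; rewrite ?(mul0r, mulr0, addr0) //.
by rewrite ?add0n ?mul1r !(rmorphN, rmorphD, rmorphB, rmorphM) /=; ring.
Qed.

Definition phi : Z2 g := basis_Z2 vir_val_cocycle.

Lemma phiE al i be j : phi (L al i) (L be j) = vir_val al i be j.
Proof. exact: basis_Z2E. Qed.

Hypothesis hq : (0 < q)%N.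

Let nq (n : nat) : (n + q)%:R != 0 :> K.
Proof. by rewrite pnatr_eq0 -lt0n addn_gt0 hq orbT. Qed.

(** If f represents the cocycle, the pair L(1,0), L(-1,0) gives f L(0,0) = 0,
against the value 1/2 on L(2,0), L(-2,0). *)
Lemma phi_nontrivial : phi \notin B2 g.
Proof.
apply/negP => /mem_B2P[f fE].
have f0 : f (L 0 0) = 0.
  have := fE (L 1 0) (L (-1) 0); rewrite linear_lie_basis phiE /vir_val subrr.
  rewrite expr1n subrr mul0r mulr0 => /esym/eqP; rewrite mulf_eq0.
  case/orP=> [|/eqP //]; rewrite intr_eq0; lia.
have := fE (L 2 0) (L (-2) 0); rewrite linear_lie_basis phiE /vir_val subrr.
rewrite [f _]f0 mulr0 !mul1r => /eqP.
have -> : (2%:~R ^+ 3 - 2%:~R : K) = 6%:R by ring.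
by rewrite mulf_eq0 invr_eq0 !pnatr_eq0.
Qed.

(** * Classification of the normalized cocycles *)

Section Normalized.
Variable w : int -> nat -> int -> nat -> K.
Hypothesis wcocycle : basis_cocycle w.
Hypothesis w0 : forall (al : int) n, al != 0 -> w 0 0 al n = 0.
Hypothesis w1 : forall n, w 1 0 (-1) n = 0.

Let wC : forall al i be j, w al i be j = - w be j al i := wcocycle.1.
Let wJ := wcocycle.2.

(** ad L(0,0) multiplies each L(al,i) by q al, so the cocycle identity with
L(0,0) multiplies the value on total weight al + be by q (al + be), and the
normalization kills the other term. *)
Lemma off_weight (al : int) i (be : int) j : al + be != 0 -> w al i be j = 0.
Proof.
move=> ab; have := wJ 0 0 al i be j.
rewrite [w (al + be) _ _ _]wC w0 // !mul0r subr0 sub0r oppr0 mulr0 addr0.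
rewrite add0r addr0 !add0n addn0 [w be _ _ _]wC mulrN -mulrBl -rmorphB /= opprK.
rewrite -mulrDl; move/eqP; rewrite mulf_eq0 => /orP[|/eqP //].
by rewrite intr_eq0 mulf_eq0 (negPf ab) /=; lia.
Qed.

Definition zero_wt (al : int) i j := w al i (- al) j.

Lemma zero_wtN al i j : zero_wt (- al) i j = - zero_wt al j i.
Proof. by rewrite /zero_wt opprK wC. Qed.

(** The cocycle identity for the weights al, be and -(al + be), rewritten by
antisymmetry so that the two-index pattern of each term is visible. *)
Lemma zero_wt_jacobi al be i j k :
  (be * (i + q)%:Z - al * (j + q)%:Z)%:~R * zero_wt (al + be) (i + j) k
  + ((al + be) * (j + q)%:Z + be * (k + q)%:Z)%:~R * zero_wt al i (j + k)
  - (al * (k + q)%:Z + (al + be) * (i + q)%:Z)%:~R * zero_wt be j (i + k) = 0.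
Proof.
have := wJ al i be j (- (al + be)) k.
have -> : be - (al + be) = - al by ring.
have -> : - (al + be) + al = - be by ring.
rewrite [w (- al) _ _ _]wC [w (- be) _ _ _]wC -!/(zero_wt _ _ _).
rewrite [(k + i)%N]addnC => <-.
by rewrite !(rmorphB, rmorphD, rmorphM, rmorphN) /=; ring.
Qed.

(** The case be = -al of the previous identity; al can be cancelled, which makes
the right-hand side independent of al and of the splitting of i + j. *)
Lemma zero_wt_shift (al : int) i j k : al != 0 ->
  (k + q)%:R * (zero_wt al (i + k) j - zero_wt al i (j + k))
  = (i + j + q.*2)%:R * zero_wt 0 (i + j) k.
Proof.
move=> al0; have := zero_wt_jacobi al (- al) i j k.
rewrite subrr (zero_wtN al) => E.
have alK : al%:~R != 0 :> K by rewrite intr_eq0.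
apply: (mulfI alK); apply/eqP; rewrite -subr_eq0 -E; apply/eqP.
by rewrite -addnn; ring.
Qed.

(** The previous identity with k = 0, where its left-hand side is zero. *)
Lemma zero_wt0n n : zero_wt 0 0 n = 0.
Proof.
have -> : zero_wt 0 0 n = - zero_wt 0 n 0 by rewrite -zero_wtN oppr0.
have /eqP := @zero_wt_shift 1 n 0 0 isT.
rewrite !addn0 subrr mulr0 eq_sym mulf_eq0 pnatr_eq0.
by case/orP=> [|/eqP ->]; [lia | rewrite oppr0].
Qed.

(** The increment of w(al;-,-) from (i,j+1) to (i+1,j) along i + j = n, as given
by zero_wt_shift with k = 1. *)
Let slope n := (n + q.*2)%:R / (1 + q)%:R * zero_wt 0 n 1.

Lemma zero_wt_step (al : int) i j : al != 0 ->
  zero_wt al i.+1 j = zero_wt al i j.+1 + slope (i + j).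
Proof.
move=> al0; have := @zero_wt_shift al i j 1 al0.
rewrite /slope !addn1 => E; apply/eqP; rewrite -subr_eq0 opprD addrA subr_eq0.
by rewrite mulrAC -E [X in X / _]mulrC mulfK // -add1n nq.
Qed.

(** For i = 0 the predecessor is harmless, since the slope has coefficient 0. *)
Lemma zero_wt_affine (al : int) i j : al != 0 ->
  zero_wt al i j = zero_wt al 0 (i + j) + i%:R * slope (i + j).-1.
Proof.
move=> al0; elim: i j => [|i IH] j; first by rewrite mul0r addr0.
by rewrite zero_wt_step // IH addnS addSn /= -addrA -natr1 mulrDl mul1r.
Qed.

(** Running through a whole line i + j = n + 1, with i = j = 0 and k = n + 1,
adds up n + 1 equal slopes to a multiple of w(0;0,n+1), which is zero. *)
Lemma slope_eq0 n : slope n = 0.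
Proof.
have /eqP := @zero_wt_shift 1 0 0 n.+1 isT.
rewrite zero_wt0n mulr0 mulf_eq0 (negPf (nq _)) /=.
rewrite !add0n zero_wt_affine // addn0 addrAC subrr add0r mulf_eq0 pnatr_eq0 /=.
by move/eqP.
Qed.

Lemma zero_wt_weight0 n k : zero_wt 0 n k = 0.
Proof.
have /eqP := @zero_wt_shift 1 n 0 k isT.
rewrite (@zero_wt_affine 1 (n + k)%N) // (@zero_wt_affine 1 n) // !slope_eq0.
rewrite !mulr0 !addr0 !(addn0, add0n) subrr.
rewrite mulr0 eq_sym mulf_eq0 pnatr_eq0; case/orP=> [|/eqP //]; lia.
Qed.

Lemma zero_wt_total_deg al i j : zero_wt al i j = zero_wt al 0 (i + j).
Proof.
have [->|al0] := eqVneq al 0; first by rewrite !zero_wt_weight0.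
by rewrite zero_wt_affine // slope_eq0 mulr0 addr0.
Qed.

(** For n > 0 the cocycle identities of degrees (n,0,0) and (0,n,0) differ by
the additivity relation, here used with be and 1 as weights. *)
Lemma zero_wt_pos_deg al n : (0 < n)%N -> zero_wt al 0 n = 0.
Proof.
move=> n0; have n0K : n%:R != 0 :> K by rewrite pnatr_eq0 -lt0n.
have step be : be + 1 != 0 -> zero_wt (be + 1) 0 n = zero_wt be 0 n.
  move=> be0.
  have E1 := zero_wt_jacobi be 1 n 0 0; have E2 := zero_wt_jacobi be 1 0 n 0.
  have zero_wt1 : zero_wt 1 0 n = 0 by exact: w1.
  have b0K : (be + 1)%:~R * n%:R != 0 :> K by rewrite mulf_neq0 // intr_eq0.
  move: E1 E2; rewrite !(addn0, add0n) !(zero_wt_total_deg _ n 0) addn0.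
  rewrite zero_wt1 => E1 E2.
  apply: (mulfI b0K); apply/eqP; rewrite -subr_eq0; apply/eqP.
  by apply: etrans (etrans (congr2 (fun x y => x - y) E1 E2) (subrr 0)); ring.
have pos (m : nat) : zero_wt m%:Z 0 n = 0.
  elim: m => [|m IH]; first exact: zero_wt_weight0.
  by rewrite -[m.+1]addn1 PoszD step; [exact: IH | lia].
case: (intP al) => [|m|m]; try exact: pos.
by rewrite zero_wtN zero_wt_total_deg addn0 pos oppr0.
Qed.

(** The recursion at al = 1 is 0 = 3 w(1), so it leaves w(2) free and determines
all the further values. *)
Lemma zero_wt_deg0 al :
  zero_wt al 0 0 = zero_wt 2 0 0 * ((al%:~R ^+ 3 - al%:~R) / 6%:R).
Proof.
have step (be : int) :
    (be + 2)%:~R * zero_wt be 0 0 = (be - 1)%:~R * zero_wt (be + 1) 0 0.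
  have := zero_wt_jacobi be 1 0 0 0.
  have zero_wt1 : zero_wt 1 0 0 = 0 by exact: w1.
  rewrite !add0n zero_wt1 mulr0 subr0 => E; apply: (mulfI (nq 0)); apply/eqP.
  by rewrite -subr_eq0 -E; apply/eqP; ring.
have pos (m : nat) :
    zero_wt m%:Z 0 0 = zero_wt 2 0 0 * ((m%:R ^+ 3 - m%:R) / 6%:R).
  case: m => [|[|m]]; first by rewrite zero_wt_weight0 expr0n subrr mul0r mulr0.
    by rewrite expr1n subrr mul0r mulr0; exact: w1.
  elim: m => [|m IH]; first by field.
  have m0 : m.+1%:R != 0 :> K by rewrite pnatr_eq0.
  apply: (mulfI m0).
  have := step m.+2; rewrite IH.
  have -> : m.+2%:Z - 1 = m.+1 by lia.
  have -> : m.+2%:Z + 1 = m.+3 by lia.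
  have -> : m.+2%:Z + 2 = m.+4 by lia.
  rewrite -!pmulrn => <-.
  by rewrite -![_.+1%:R]natr1; field.
case: (intP al) => [|m|m]; rewrite ?zero_wtN pos -?pmulrn //.
by rewrite rmorphN /= -!pmulrn; ring.
Qed.

Lemma normalized_multiple al i be j :
  w al i be j = zero_wt 2 0 0 * 2%:R * vir_val al i be j.
Proof.
rewrite /vir_val.
have [ab|ab] := eqVneq (al + be) 0; last by rewrite off_weight // !mul0r mulr0.
have -> : be = - al by apply/eqP; rewrite -addr_eq0 addrC ab.
rewrite -/(zero_wt al i j) zero_wt_total_deg.
have [ij|ij] := posnP (i + j)%N; last first.
  by rewrite zero_wt_pos_deg //; case: i j ij => [|i] [|j] //= _;
    rewrite !(mul0r, mulr0).
case: i j ij => [|i] [|j] //= _; rewrite addn0 zero_wt_deg0 !mul1r.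
by field; rewrite ?pnatr_eq0.
Qed.

End Normalized.

(** * Cohomology classes and extensions *)

(** The form f below is the normalization: it is chosen so that the difference
with the coboundary vanishes on L(0,0), L(al,n) for al nonzero and on
L(1,0), L(-1,n). *)
Lemma cocycle_class (psi : Z2 g) : exists a : K, equiv_cocycle psi (a *: phi).
Proof.
pose F (al : int) (n : nat) : K :=
  if al == 0 then - psi (L 1 0) (L (-1) n) / (n + q.*2)%:R
  else psi (L 0 0) (L al n) / (al%:~R * q%:R).
have [f fE] := linear_of (@block_lin_linear K^o F).
pose chi := psi - coboundary f.
have chiE al i be j : chi (L al i) (L be j) = psi (L al i) (L be j) -
    (be * (i + q)%:Z - al * (j + q)%:Z)%:~R * F (al + be) (i + j)%N.
  by rewrite /chi Z2B /= linear_lie_basis fE block_linE.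
pose w al i be j : K := chi (L al i) (L be j).
have wcocycle : basis_cocycle w := cocycle_basis chi.
have w0 al n : al != 0 -> w 0 0 al n = 0.
  move=> al0; rewrite /w chiE !add0r add0n /F (negPf al0) mul0r subr0.
  by rewrite rmorphM /= mulrC mulfVK ?subrr // mulf_neq0 ?intr_eq0 // (nq 0).
have w1 n : w 1 0 (-1) n = 0.
  rewrite /w chiE subrr /F eqxx add0n.
  have -> : -1 * q%:Z - 1 * (n + q)%N%:Z = - (n + q.*2)%N%:Z by lia.
  rewrite rmorphN /= mulNr -pmulrn mulNr mulrN opprK mulrC mulfVK ?subrr //.
  by rewrite pnatr_eq0; lia.
exists (w 2 0 (-2) 0 * 2%:R); rewrite /equiv_cocycle.
have <- : chi = (w 2 0 (-2) 0 * 2%:R) *: phi.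
  apply: Z2_eq => al i be j; rewrite Z2Z phiE -/(w al i be j).
  exact: normalized_multiple.
by rewrite /chi opprD opprK addNKr; apply/asboolP; exists f.
Qed.

(** A linear section exists because its values on the basis can be chosen
freely. *)
Lemma block_ext_section (E : centralExt g) :
  {s : {linear g -> E} | cancel s (ext_proj E)}.
Proof.
pose F al i := projT1 (cid (ext_proj_surj E (L al i))).
have [s sE] := linear_of (block_lin_linear F).
exists s; apply: block_linear_eq => [a u v|//|al i]; first by rewrite !linearP.
by rewrite sE block_linE /F; case: cid.
Qed.

Lemma block_ext_unique (E : centralExt g) :
  ~ trivial_ext E -> equiv_ext E (cocycle_ext phi).
Proof.
move=> nE; have [s sK] := block_ext_section E.
have [k kE] := central_coord sK.
have [a psia] := cocycle_class (section_cocycle sK kE).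
apply: (equiv_cocycle_ext _ psia); apply/eqP => a0; apply: nE.
apply: (@section_cocycle_trivial _ _ _ _ sK _ kE).
by move: psia; rewrite a0 /equiv_cocycle scale0r subr0.
Qed.

Lemma cext_lie_block al i be j :
  lie (cext_in phi (L al i)) (cext_in phi (L be j)) =
    (be * (i + q)%:Z - al * (j + q)%:Z)%:~R
        *: cext_in phi (L (al + be) (i + j))
      + phi (L al i) (L be j) *: cext_c phi.
Proof.
apply: (congr2 pair) => /=.
  by rewrite scaler0 addr0; exact: lie_blockL.
by rewrite scaler0 add0r /GRing.scale /= mulr1.
Qed.

End Block.

Theorem theorem4p1 (R : realType) (q : nat) (hq : (0 < q)%N) :
  exists phi : Z2 (block R[i] q),
    (* the values of phi on the basis, which determine phi by bilinearity *)
    (forall (alpha beta : int) (i j : nat),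
      phi (blockL R[i] q alpha i) (blockL R[i] q beta j) =
        (alpha + beta == 0)%:R * (i == 0%N)%:R * (j == 0%N)%:R
          * ((alpha%:~R ^+ 3 - alpha%:~R) / 12%:R) :> R[i]) /\
    (* phi is not trivial *)
    phi \notin B2 (block R[i] q) /\
    (* every nontrivial cocycle is equivalent to a nonzero multiple of phi *)
    (forall psi : Z2 (block R[i] q), psi \notin B2 (block R[i] q) ->
      exists2 a : R[i], a != 0 & equiv_cocycle psi (a *: phi)) /\
    (* the bracket of the extension defined by phi *)
    (forall (alpha beta : int) (i j : nat),
      lie (cext_in phi (blockL R[i] q alpha i))
          (cext_in phi (blockL R[i] q beta j)) =
        (beta * (i + q)%:Z - alpha * (j + q)%:Z)%:~R
            *: cext_in phi (blockL R[i] q (alpha + beta) (i + j))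
          + phi (blockL R[i] q alpha i) (blockL R[i] q beta j)
            *: cext_c phi) /\
    (* this extension is the unique nontrivial one-dimensional one *)
    ~ trivial_ext (cocycle_ext phi) /\
    (forall E : centralExt (block R[i] q), ~ trivial_ext E ->
      equiv_ext E (cocycle_ext phi)) /\
    (* the second cohomology group is the line spanned by the class of phi *)
    H2class phi <> 0 /\
    (forall h : H2 (block R[i] q), exists a : R[i], h = a *: H2class phi).
Proof.
have nphi := phi_nontrivial R[i] hq.
have H0 : H2class (0 : Z2 (block R[i] q)) = 0.
  by rewrite -(scale0r (0 : Z2 _)) H2classZ; exact: scale0r.
exists (phi R[i] q); split=> [alpha beta i j|]; first exact: phiE.
split; first exact: nphi.
split.
  move=> psi npsi; have [a psia] := cocycle_class hq psi; exists a => //.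
  apply: contra npsi => /eqP a0; move: psia.
  by rewrite a0 /equiv_cocycle scale0r subr0.
split=> [alpha beta i j|]; first exact: cext_lie_block.
split; first by move=> /trivial_cocycle_ext; exact/negP.
split; first exact: block_ext_unique.
split.
  by rewrite -H0 => /H2class_eq; rewrite /equiv_cocycle subr0; exact/negP.
move=> h; have [a ha] := cocycle_class hq (repr (h : {ideal_quot B2 _})).
exists a; rewrite -[LHS]H2class_repr.
by apply: etrans (H2classZ a _); apply/H2class_eq.
Qed.
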